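(* For any positive integer $n$ coprime to $6$ and any integers $k_1,k_2,k_3\geq 0$, \[ \omega\left(15^{k_1}\,21^{k_2}\,27^{k_3}\,n\right)\geq 4. \]
   Context: For a positive integer $k$, $\mathbb{Z}_k$ denotes the integers modulo $k$. $G_k$ is the graph whose vertices are the functions $f:\mathbb{Z}_k\to\mathbb{Z}_k$, where a pair of vertices $\{f,g\}$ forms an edge if the pointwise difference $f-g$ (taken modulo $k$) is a bijection $\mathbb{Z}_k\to\mathbb{Z}_k$. $\omega(k)$ denotes the size of the largest clique (complete subgraph) in $G_k$.
   Formalization: The formal theorem additionally assumes 15^{k_1} 21^{k_2} 27^{k_3} n > 1, excluding only n = 1, k_1 = k_2 = k_3 = 0, where G_1 has a single vertex and ω(1) = 1 < 4, so the claim is false. *)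

(* Defs.v *)
From mathcomp Require Import all_boot all_order all_algebra.

Set Implicit Arguments.
Unset Strict Implicit.
Unset Printing Implicit Defensive.

Import GRing.Theory.

(* The integers modulo k, for every k >= 1, with the library's addition modulo
   k on 'I_n.+1.  The library's 'Z_k is not used because 'Z_1 is Z/2.  The
   value at k = 0 is junk (it is the trivial group). *)
Notation Zmod k := 'I_k.-1.+1.

Notation vertex k := {ffun Zmod k -> Zmod k}.

Definition bijectiveb (T U : finType) (h : T -> U) : bool :=
  injectiveb h && [forall y, exists x, h x == y].

Lemma bijectivebP (T U : finType) (h : T -> U) :
  reflect (bijective h) (bijectiveb h).
Proof.
apply: (iffP andP) => [[/injectiveP hinj /forallP hsurj] | hbij].
  have hs y : {x | h x == y} by apply/sigW/existsP/hsurj.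
  exists (fun y => sval (hs y)) => [x | y]; last by apply/eqP/(svalP (hs y)).
  by apply: hinj; apply/eqP/(svalP (hs (h x))).
split; first by apply/injectiveP/bij_inj.
by case: hbij => g _ gK; apply/forallP => y; apply/existsP; exists (g y); rewrite gK.
Qed.

(* G_k as a simple graph: f - g is the pointwise difference modulo k.  The
   condition f != g only matters at k = 1, where 0 is a bijection. *)
Definition adj (k : nat) : rel (vertex k) :=
  fun f g => (f != g) && bijectiveb (f - g)%R.

Definition clique (k : nat) (S : {set vertex k}) : bool :=
  [forall f in S, forall g in S, (f != g) ==> adj f g].

Definition omega (k : nat) : nat :=
  \max_(S : {set vertex k} | clique S) #|S|.

(* Main.v *)
Require Import Defs.
From mathcomp Require Import all_boot all_order all_algebra.

(** Cliques of size r can be encoded by r integer-valued functions on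
    {0, ..., m-1} whose pairwise differences are injective modulo m.  In this
    form cliques multiply: writing x < m * n as x = a + m * b, the functions
    F i a + m * G i b work modulo m * n, because a difference determines a
    modulo m, and then b modulo n; carries play no role.  It remains to treat
    the factors: for n coprime to 6 the functions 0, x, 2x, 3x do, and for 15,
    21 and 27 explicit pairs of orthogonal orthomorphisms are given. *)

(* Differences are moved across the congruence to avoid truncated subtraction. *)
Definition diff_family (r m : nat) : Prop :=
  exists F : 'I_r -> nat -> nat, forall i j, i != j ->
    forall a b, a < m -> b < m ->
      F i a + F j b = F i b + F j a %[mod m] -> a = b.

Lemma diff_family1 r : diff_family r 1.
Proof. by exists (fun _ _ => 0) => i j _ [|a] [|b]. Qed.

Lemma diff_familyM r m n :
  diff_family r m -> diff_family r n -> diff_family r (m * n).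
Proof.
move=> [F hF] [G hG].
exists (fun i x => F i (x %% m) + m * G i (x %/ m)) => i j ij x y.
have [-> //|m0] := posnP m.
move=> xlt ylt; rewrite addnACA [in RHS]addnACA -!mulnDr => e.
have exy : x %% m = y %% m.
  apply: (hF i j ij); rewrite ?ltn_mod //.
  have /(congr1 (modn^~ m)) := e.
  by rewrite !(modn_dvdm _ (dvdn_mulr _ (dvdnn m))) ![_ + m * _]addnC ![m * _]mulnC !modnMDl.
rewrite (divn_eq x m) (divn_eq y m) exy; congr (_ * _ + _).
apply: (hG i j ij); rewrite ?ltn_divLR 1?mulnC //.
(* The equal low digits cancel, and the common factor [m] is divided out of both sides and the
   modulus. *)
move/eqP: e; rewrite exy eqn_modDl -!muln_modr eqn_pmul2l //.
by move/eqP.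
Qed.

Lemma diff_familyX r m k : diff_family r m -> diff_family r (m ^ k).
Proof.
move=> hm; elim: k => [|k IH]; first exact: diff_family1.
by rewrite expnS; apply: diff_familyM.
Qed.

(** For [i < j], the factor [j - i] lies between 1 and [r.-1], so it divides the factorial and is a
    unit modulo [n]. *)
Lemma diff_family_coprime r n : coprime n r.-1`! -> diff_family r n.
Proof.
move=> cop; exists (fun i a => i * a) => i j.
wlog ltij : i j / i < j => [hw ij a b an bn e|].
  have [lt|lt|/val_inj eq] := ltngtP i j; last by rewrite eq eqxx in ij.
    exact: (hw i j).
  by apply/esym/(hw j i); rewrite // 1?eq_sym // ![j * _ + _]addnC.
move=> _ a b an bn /eqP.
have cop_d : coprime n (j - i).
  apply: coprime_dvdr cop; apply: dvdn_fact; rewrite subn_gt0 ltij /=.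
  by rewrite -ltnS (leq_ltn_trans (leq_subr i j)) ?(ltn_predK (ltn_ord j)).
have split c : j * c = i * c + (j - i) * c by rewrite -mulnDl subnKC // ltnW.
rewrite !split !addnA [i * b + i * a]addnC eqn_modDl.
wlog ab : a b an bn / a <= b => [hw e|].
  by have [|/ltnW] := leqP a b => le; [|apply/esym]; apply: hw; rewrite // 1?eq_sym.
rewrite eqn_mod_dvd ?leq_mul2l ?ab ?orbT // -mulnBr Gauss_dvdr // => dv.
apply/eqP; rewrite eqn_leq ab -subn_eq0 /=.
move: dv; rewrite /dvdn modn_small //.
exact: leq_ltn_trans (leq_subr _ _) bn.
Qed.

(* [m.-1 * y] is [- y] modulo [m], for every natural number [y]. *)
Definition is_diff_table (m : nat) (T : seq (seq nat)) : bool :=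
  all2rel (fun s t => (s == t) ||
    uniq [seq (nth 0 s a + m.-1 * nth 0 t a) %% m | a <- iota 0 m]) T.

Lemma diff_family_table r m (T : seq (seq nat)) :
  uniq T -> size T = r -> is_diff_table m T -> diff_family r m.
Proof.
move=> uT sT /allrelP hT.
exists (fun i => nth 0 (nth [::] T i)) => i j ij a b am bm e.
have iT k : k < r -> nth [::] T k \in T by move=> kr; rewrite mem_nth ?sT.
have /orP[|u] := hT _ _ (iT _ (ltn_ord i)) (iT _ (ltn_ord j)).
  by rewrite nth_uniq ?sT // => /eqP/val_inj eq; rewrite eq eqxx in ij.
have m0 : 0 < m by apply: leq_ltn_trans am.
move: e u; set s := nth _ T i; set t := nth _ T j => e u.
have nthE c : c < m -> nth 0 (iota 0 m) c = c by move=> cm; rewrite nth_iota.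
apply/eqP; rewrite -(nth_uniq 0 _ _ u) ?size_map ?size_iota //.
rewrite !(nth_map 0) ?size_iota // !nthE //.
(* Adding both entries of [t] cancels the two negations and leaves [e]. *)
rewrite -(eqn_modDr (nth 0 t a + nth 0 t b)).
have neg x y z : x + m.-1 * y + (y + z) = y * m + (x + z).
  by rewrite addnA -[x + _ + y]addnA -mulSnr prednK // [m * y]mulnC [x + _]addnC -addnA.
by rewrite neg [nth 0 t a + _]addnC neg !modnMDl e.
Qed.

(* The tables come from a computer search among those whose set of columns
   (0, x, y, z) is invariant under negation and, for 21 and 27, also under
   (x, y, z) |-> u * (y, z, x) up to sign, with u = 16 and u = 19 respectively. *)
Lemma diff_family_15 : diff_family 4 15.
Proof.
pose T := [:: nseq 15 0; iota 0 15;
  [:: 0; 3; 8; 11; 14; 2; 10; 6; 9; 5; 13; 1; 4; 7; 12];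
  [:: 0; 7; 3; 10; 2; 9; 1; 4; 11; 14; 6; 13; 5; 12; 8]].
by apply: (@diff_family_table _ _ T); vm_compute.
Qed.

Lemma diff_family_21 : diff_family 4 21.
Proof.
pose T := [:: nseq 21 0; iota 0 21;
  [:: 0; 15; 8; 14; 3; 17; 10; 2; 5; 1; 12; 9; 20; 16; 19; 11; 4; 18; 7;
      13; 6];
  [:: 0; 4; 11; 13; 19; 3; 1; 15; 9; 16; 14; 7; 5; 12; 6; 20; 18; 2; 8;
      10; 17]].
by apply: (@diff_family_table _ _ T); vm_compute.
Qed.

Lemma diff_family_27 : diff_family 4 27.
Proof.
pose T := [:: nseq 27 0; iota 0 27;
  [:: 0; 16; 22; 26; 6; 23; 12; 18; 25; 17; 7; 24; 13; 8; 19; 14; 3; 20;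
      10; 2; 9; 15; 4; 21; 1; 5; 11];
  [:: 0; 18; 26; 7; 12; 14; 22; 19; 3; 2; 23; 10; 6; 11; 16; 21; 17; 4;
      25; 24; 8; 5; 13; 15; 20; 1; 9]].
by apply: (@diff_family_table _ _ T); vm_compute.
Qed.

Lemma leq_omega r m : 1 < m -> diff_family r m -> r <= omega m.
Proof.
case: m => // m m1 [F hF].
pose f i : vertex m.+1 := [ffun a => inZp (F i (val a))].
have f_inj i j : i != j -> injective (f i - f j)%R.
  move=> ij a b; rewrite !ffunE => /eqP.
  rewrite GRing.subr_eq GRing.addrAC eq_sym GRing.subr_eq => /eqP/(congr1 val) /=.
  rewrite !modnDm => e; apply: val_inj.
  by apply: (hF i j ij); rewrite ?ltn_ord.
(* Equal vertices would make the zero map injective, yet [ord0] and [ord_max] differ since the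
   modulus exceeds 1. *)
have injf : injective f.
  move=> i j eq; apply/eqP; apply: contraTT isT => /f_inj; rewrite eq GRing.subrr.
  move/(_ ord0 ord_max); rewrite !ffunE => /(_ erefl)/(congr1 val) /= e.
  by rewrite -e in m1.
rewrite -[X in X <= _]card_ord -(card_imset _ injf).
apply: (@leq_bigmax_cond _ _ (fun S : {set vertex m.+1} => #|S|)).
apply/forall_inP => _ /imsetP[i _ ->]; apply/forall_inP => _ /imsetP[j _ ->].
apply/implyP => ne; rewrite /adj ne; apply/bijectivebP/injF_bij/f_inj.
by apply: contraNneq ne => ->.
Qed.

Theorem mainTheorem3 (n k1 k2 k3 : nat) (hn : 0 < n) (hn6 : coprime n 6)
    (hk : 1 < 15 ^ k1 * 21 ^ k2 * 27 ^ k3 * n) :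
  4 <= omega (15 ^ k1 * 21 ^ k2 * 27 ^ k3 * n).
Proof.
(* The factorial of 3 is 6, so [hn6] is the coprimality required for the factor [n]. *)
apply: leq_omega hk _; apply: diff_familyM; last exact: diff_family_coprime.
by do 2?apply: diff_familyM; apply: diff_familyX;
  [exact: diff_family_15 | exact: diff_family_21 | exact: diff_family_27].
Qed.
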